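(* Let $\lambda\in\mathbb{R}$ and let $f$ be an infinitely differentiable function on $(0,\infty)$. Let $D=\frac{d}{dx}$. For every integer $n\ge 0$ and every $x>0$, \[ \big(x^{1-\lambda}D\big)^{n}f(x)=\sum_{k=0}^{n}S_{2,\lambda}(n,k)\,x^{k-n\lambda}D^{k}f(x), \] where $\big(x^{1-\lambda}D\big)^n$ denotes the $n$-fold iterate of the operator $g\mapsto x^{1-\lambda}g'$.
   Context: For $\lambda\in\mathbb{R}$, $(x)_{0,\lambda}=1$ and $(x)_{n,\lambda}=x(x-\lambda)\cdots(x-(n-1)\lambda)$ for $n\ge1$; $(x)_0=1$ and $(x)_n=x(x-1)\cdots(x-n+1)$ for $n\ge 1$. The degenerate Stirling numbers of the second kind $S_{2,\lambda}(n,k)$ are defined by $(x)_{n,\lambda}=\sum_{k=0}^{n}S_{2,\lambda}(n,k)(x)_{k}$ (with $S_{2,\lambda}(n,k)=0$ for $k<0$ or $k>n$). *)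

(* Defs.v *)
From Stdlib Require Import Reals Arith Lra Lia.
Open Scope R_scope.

Fixpoint falling (x : R) (n : nat) : R :=
  match n with
  | O => 1
  | S m => falling x m * (x - INR m)
  end.

Fixpoint degenerate_falling (lambda x : R) (n : nat) : R :=
  match n with
  | O => 1
  | S m => degenerate_falling lambda x m * (x - INR m * lambda)
  end.

Definition is_degenerate_stirling2 (lambda : R) (s : nat -> nat -> R) : Prop :=
  (forall (n : nat) (x : R),
     degenerate_falling lambda x n = sum_f_R0 (fun k => s n k * falling x k) n) /\
  (forall n k : nat, (n < k)%nat -> s n k = 0).

Lemma degenerate_stirling2_exists (lambda : R) :
  {s : nat -> nat -> R | is_degenerate_stirling2 lambda s}.
Proof.
set (s := fix s (n k : nat) {struct n} : R :=
  match n, k with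
  | O, O => 1
  | O, S _ => 0
  | S m, O => - (INR m * lambda) * s m O
  | S m, S j => s m j + (INR (S j) - INR m * lambda) * s m (S j)
  end).
assert (H0 : forall n k, (n < k)%nat -> s n k = 0).
{ induction n as [|n IH]; intros [|k] Hk; try lia; simpl; auto.
  rewrite !IH by lia; ring. }
exists s; split; [|exact H0].
intros n x; induction n as [|n IH].
- simpl; ring.
- change (degenerate_falling lambda x (S n))
    with (degenerate_falling lambda x n * (x - INR n * lambda)).
  rewrite IH.
  assert (H : forall m,
    sum_f_R0 (fun k => s n k * falling x k) m * (x - INR n * lambda) =
    sum_f_R0 (fun k => s (S n) k * falling x k) m + s n m * falling x (S m)).
  { induction m as [|m IHm].
    - simpl; ring.
    - rewrite !tech5, Rmult_plus_distr_r, IHm.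
      change (s (S n) (S m)) with (s n m + (INR (S m) - INR n * lambda) * s n (S m)).
      change (falling x (S (S m))) with (falling x (S m) * (x - INR (S m))).
      ring. }
  rewrite H, tech5.
  change (s (S n) (S n)) with (s n n + (INR (S n) - INR n * lambda) * s n (S n)).
  rewrite (H0 n (S n)) by lia.
  ring.
Qed.

(* The witness is opaque on purpose: only the defining expansion matters, and
   it determines the numbers (degenerate_stirling2_unique). *)
Definition degenerate_stirling2 (lambda : R) : nat -> nat -> R :=
  proj1_sig (degenerate_stirling2_exists lambda).

Lemma degenerate_stirling2_spec (lambda : R) :
  is_degenerate_stirling2 lambda (degenerate_stirling2 lambda).
Proof. exact (proj2_sig (degenerate_stirling2_exists lambda)). Qed.

Lemma falling_INR_0 (j k : nat) : (j < k)%nat -> falling (INR j) k = 0.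
Proof.
induction k as [|k IH]; intros H; [lia|]; simpl.
destruct (Nat.eq_dec j k) as [->|Hn]; [ring|rewrite IH by lia; ring].
Qed.

Lemma falling_INR_pos (j k : nat) : (k <= j)%nat -> 0 < falling (INR j) k.
Proof.
induction k as [|k IH]; intros H; simpl; [lra|].
apply Rmult_lt_0_compat; [apply IH; lia|].
assert (INR k < INR j) by (apply lt_INR; lia); lra.
Qed.

Lemma sum_falling_INR (a : nat -> R) (j n : nat) : (j <= n)%nat ->
  sum_f_R0 (fun k => a k * falling (INR j) k) n =
  sum_f_R0 (fun k => a k * falling (INR j) k) j.
Proof.
induction 1 as [|n H IH]; [reflexivity|].
rewrite tech5, IH, falling_INR_0 by lia; ring.
Qed.

Lemma degenerate_stirling2_unique (lambda : R) (s : nat -> nat -> R) :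
  is_degenerate_stirling2 lambda s ->
  forall n k : nat, s n k = degenerate_stirling2 lambda n k.
Proof.
intros [Hs Hs0] n k.
destruct (degenerate_stirling2_spec lambda) as [Ht Ht0].
set (t := degenerate_stirling2 lambda) in *.
induction k as [k IH] using lt_wf_ind.
destruct (Nat.lt_ge_cases n k) as [Hk|Hk]; [now rewrite Hs0, Ht0|].
pose proof (eq_trans (eq_sym (Hs n (INR k))) (Ht n (INR k))) as E.
rewrite (sum_falling_INR (s n)), (sum_falling_INR (t n)) in E by exact Hk.
pose proof (falling_INR_pos k k (le_n k)) as P.
destruct k as [|k].
- simpl in E; lra.
- rewrite !tech5 in E.
  rewrite (sum_eq (fun i => s n i * falling (INR (S k)) i)
             (fun i => t n i * falling (INR (S k)) i)) in E
    by (intros i Hi; rewrite IH by lia; reflexivity).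
  apply Rplus_eq_reg_l, Rmult_eq_reg_r in E; lra.
Qed.

(* Main.v *)
Require Import Defs.
From Stdlib Require Import Reals Lra Lia.
From Coquelicot Require Import Coquelicot.
Open Scope R_scope.

(** Both sides satisfy the same recursion in [n]: applying [x^(1-lambda) D] to
    [x^(k - n lambda) D^k f] yields
    [(k - n lambda) x^(k - (n+1) lambda) D^k f + x^(k+1 - (n+1) lambda) D^(k+1) f],
    which matches the triangular recurrence
    [S(n+1, k) = S(n, k-1) + (k - n lambda) S(n, k)]. *)

Definition stirling2_step (lambda : R) (n : nat) (row : nat -> R) (k : nat) : R :=
  match k with O => 0 | S j => row j end + (INR k - INR n * lambda) * row k.

(** Re-indexing [row k * b (S k)] feeds the entry at [S k]; the last shifted term overshoots [m] and
    stays outside. With [b] arbitrary, the identity serves both the falling factorials and the terms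
    of the derivative formula. *)
Lemma sum_stirling2_step (lambda : R) (n : nat) (row b : nat -> R) (m : nat) :
  sum_f_R0 (fun k => row k * ((INR k - INR n * lambda) * b k + b (S k))) m
  = sum_f_R0 (fun k => stirling2_step lambda n row k * b k) m + row m * b (S m).
Proof.
induction m as [|m IHm].
- unfold stirling2_step; simpl; ring.
- rewrite !tech5, IHm; unfold stirling2_step; ring.
Qed.

Lemma sum_stirling2_step_full (lambda : R) (n : nat) (row b : nat -> R) :
  row (S n) = 0 ->
  sum_f_R0 (fun k => row k * ((INR k - INR n * lambda) * b k + b (S k))) n
  = sum_f_R0 (fun k => stirling2_step lambda n row k * b k) (S n).
Proof.
intros H.
rewrite sum_stirling2_step, tech5.
unfold stirling2_step at 3; rewrite H; ring.
Qed.

(* Stepping every row of the array yields an array with the defining property,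
   so uniqueness gives the recurrence. *)
Lemma degenerate_stirling2_S (lambda : R) (n k : nat) :
  degenerate_stirling2 lambda (S n) k
  = stirling2_step lambda n (degenerate_stirling2 lambda n) k.
Proof.
destruct (degenerate_stirling2_spec lambda) as [Hs Hs0].
set (s := degenerate_stirling2 lambda) in *.
(* Each later row of [t] steps a row of [s], not of [t], so the known expansion of [s m] applies
   without induction. *)
set (t := fun n => match n with
  | O => s O | S m => stirling2_step lambda m (s m) end).
symmetry; refine (degenerate_stirling2_unique lambda t _ (S n) k); split.
- intros [|m] x; [exact (Hs O x)|].
  change (degenerate_falling lambda x (S m))
    with (degenerate_falling lambda x m * (x - INR m * lambda)).
  unfold t.
  (* For [b = falling x], [b (S k) = (x - k) * b k], so each bracket collapses to
     [(x - m * lambda) * b k]. *)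
  rewrite <- (sum_stirling2_step_full lambda m (s m) (falling x)) by (apply Hs0; lia).
  rewrite Hs, Rmult_comm, scal_sum.
  apply sum_eq; intros i _; simpl; ring.
- intros [|m] [|j] Hj; try lia; [apply Hs0; lia|].
  unfold t, stirling2_step; rewrite !Hs0 by lia; ring.
Qed.

Lemma degenerate_stirling2_0_0 (lambda : R) : degenerate_stirling2 lambda 0 0 = 1.
Proof.
destruct (degenerate_stirling2_spec lambda) as [Hs _].
specialize (Hs O 0); simpl in Hs; lra.
Qed.

Lemma is_derive_sum_f_R0 (u : nat -> R -> R) (du : nat -> R) (x : R) (m : nat) :
  (forall k, is_derive (u k) x (du k)) ->
  is_derive (fun y => sum_f_R0 (fun k => u k y) m) x (sum_f_R0 du m).
Proof.
intros H; induction m as [|m IHm]; [apply H|].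
exact (is_derive_plus _ (u (S m)) x _ _ IHm (H (S m))).
Qed.

Lemma is_derive_Rpower (a x : R) :
  0 < x -> is_derive (fun y => Rpower y a) x (a * Rpower x (a - 1)).
Proof.
intros Hx; apply is_derive_Reals; now apply derivable_pt_lim_power.
Qed.

Theorem theorem11 (lambda : R) (f : R -> R)
  (f_smooth : forall (k : nat) (x : R), 0 < x -> ex_derive_n f k x)
  (n : nat) (x : R) (x_pos : 0 < x) :
  Nat.iter n (fun (g : R -> R) (y : R) => Rpower y (1 - lambda) * Derive g y) f x
  = sum_f_R0 (fun k : nat =>
      degenerate_stirling2 lambda n k
      * Rpower x (INR k - INR n * lambda) * Derive_n f k x) n.
Proof.
revert x x_pos; induction n as [|n IHn]; intros x x_pos.
- simpl.
  replace (0 - 0 * lambda) with 0 by ring.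
  rewrite degenerate_stirling2_0_0, Rpower_O by exact x_pos; ring.
- rewrite Nat.iter_succ.
  set (s := degenerate_stirling2 lambda) in *.
  set (a := fun k => INR k - INR n * lambda).
  (* The induction hypothesis holds only for positive arguments; as the half-line is open, this
     gives equality near [x], enough to differentiate. *)
  rewrite (Derive_ext_loc _ (fun y : R => sum_f_R0 (fun k =>
      s n k * Rpower y (a k) * Derive_n f k y) n)).
  2: { apply (filter_imp (fun y => 0 < y)); [exact IHn|].
       exact (open_gt 0 x x_pos). }
  assert (Hd : is_derive (fun y : R => sum_f_R0 (fun k =>
      s n k * Rpower y (a k) * Derive_n f k y) n) x
    (sum_f_R0 (fun k => s n k * (a k * Rpower x (a k - 1)) * Derive_n f k x
      + s n k * Rpower x (a k) * Derive_n f (S k) x) n)).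
  { apply is_derive_sum_f_R0; intros k.
    apply (is_derive_mult (fun y => s n k * Rpower y (a k)) (Derive_n f k)).
    - apply is_derive_scal; now apply is_derive_Rpower.
    - apply Derive_correct; exact (f_smooth (S k) x x_pos).
    - exact Rmult_comm. }
  rewrite (is_derive_unique _ _ _ Hd), scal_sum.
  (* The outer factor [x^(1 - lambda)] is absorbed here: it raises the exponents [a k - 1] and [a k]
     to those in [b k] and [b (S k)]. *)
  set (b := fun k => Rpower x (INR k - INR (S n) * lambda) * Derive_n f k x).
  rewrite (sum_eq _ (fun k => s n k * ((INR k - INR n * lambda) * b k + b (S k)))).
  + rewrite sum_stirling2_step_full
      by (apply (proj2 (degenerate_stirling2_spec lambda)); lia).
    apply sum_eq; intros k _.
    unfold s; rewrite degenerate_stirling2_S; unfold b; ring.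
  + intros k _; fold (a k); unfold b.
    replace (INR k - INR (S n) * lambda) with ((a k - 1) + (1 - lambda))
      by (unfold a; rewrite S_INR; ring).
    replace (INR (S k) - INR (S n) * lambda) with (a k + (1 - lambda))
      by (unfold a; rewrite !S_INR; ring).
    rewrite !Rpower_plus; ring.
Qed.
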